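(* Let $C\subset S^{D-1}$ and $Y\subset S^{k-1}$ be kissing configurations. Let $\ell\ge 1$, let $t_1,\dots,t_\ell\in\mathbb{R}^k$ be distinct vectors with $0<\|t_i\|<1$, and put $a_i=\sqrt{1-\|t_i\|^2}$. Let $A_1,\dots,A_\ell\subseteq C$ and $U=\bigcup_i A_i$. Define subsets of $\mathbb{R}^{D+k}=\mathbb{R}^D\oplus\mathbb{R}^k$ by $$Z=\{(x,0):x\in C\setminus U\},\qquad M=\bigcup_{i=1}^{\ell}\{(a_i x,t_i):x\in A_i\},\qquad P=\{(0,y):y\in Y\}.$$ Then $Z\cup M\cup P$ is a kissing configuration if and only if both of the following hold: (i) $a_i a_j\langle x,x'\rangle+\langle t_i,t_j\rangle\le\frac12$ whenever $x\in A_i$, $x'\in A_j$ and $(x,i)\ne(x',j)$; (ii) $\langle t_i,y\rangle\le\frac12$ for every $i$ with $A_i\ne\varnothing$ and every $y\in Y$.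
   Context: A kissing configuration in $S^{n-1}\subset\mathbb{R}^n$ is a set of unit vectors whose distinct members have inner product at most $\tfrac12$. *)

(* Defs.v *)
From HB Require Import structures.
From mathcomp Require Import all_boot all_order all_algebra.
From mathcomp Require Import classical_sets reals.

Set Implicit Arguments.
Unset Strict Implicit.
Unset Printing Implicit Defensive.

Import Order.TTheory GRing.Theory Num.Theory.

Local Open Scope classical_set_scope.
Local Open Scope ring_scope.

Definition dotp (R : realType) (n : nat) (u v : 'rV[R]_n) : R :=
  \sum_(i < n) u 0 i * v 0 i.

(* The library norm `|u| on row vectors is the sup norm, hence this one. *)
Definition enorm (R : realType) (n : nat) (u : 'rV[R]_n) : R :=
  Num.sqrt (dotp u u).

Definition unit_sphere (R : realType) (n : nat) : set 'rV[R]_n :=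
  [set u | enorm u = 1].

Definition kissing_configuration (R : realType) (n : nat) (K : set 'rV[R]_n) :=
  K `<=` @unit_sphere R n /\
  forall u v, K u -> K v -> u <> v -> dotp u v <= 1 / 2.

(* Main.v *)
Require Import Defs.
From HB Require Import structures.
From mathcomp Require Import all_boot all_order all_algebra.
From mathcomp Require Import lra.
From mathcomp Require Import classical_sets reals.

Set Implicit Arguments.
Unset Strict Implicit.
Unset Printing Implicit Defensive.

Import Order.TTheory GRing.Theory Num.Theory.

Local Open Scope classical_set_scope.
Local Open Scope ring_scope.

(** The two summands of the direct sum are orthogonal, so inner products split blockwise
    ([dotp_row_mx]), and the claim becomes a check of pairs by type. Every point is a unit vector,
    since [a i] is chosen so that the two squared block norms in [M] add up to 1. Pairs inside [Z]
    or inside [P] inherit the bound from [C] or [Y], and a [Z]-[P] pair is orthogonal. A [Z]-[M]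
    pair has the inner product of two distinct points of [C], scaled by some [a i] in (0, 1]. Only
    [M]-[M] and [M]-[P] pairs remain, and their bounds are literally (i) and (ii). Conversely, (i)
    and (ii) can be read off once the points involved are known to be distinct. *)

Section DotProduct.
Context {R : realType}.

Lemma dotpC n (u v : 'rV[R]_n) : dotp u v = dotp v u.
Proof. by apply: eq_bigr => i _; rewrite mulrC. Qed.

Lemma dotp0l n (v : 'rV[R]_n) : dotp 0 v = 0.
Proof. by rewrite /dotp big1 // => i _; rewrite mxE mul0r. Qed.

Lemma dotp0r n (v : 'rV[R]_n) : dotp v 0 = 0.
Proof. by rewrite dotpC dotp0l. Qed.

Lemma dotpZl n c (u v : 'rV[R]_n) : dotp (c *: u) v = c * dotp u v.
Proof. by rewrite /dotp mulr_sumr; apply: eq_bigr => i _; rewrite mxE mulrA. Qed.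

Lemma dotpZr n c (u v : 'rV[R]_n) : dotp u (c *: v) = c * dotp u v.
Proof. by rewrite dotpC dotpZl dotpC. Qed.

Lemma dotp_row_mx m n (u u' : 'rV[R]_m) (v v' : 'rV[R]_n) :
  dotp (row_mx u v) (row_mx u' v') = dotp u u' + dotp v v'.
Proof.
rewrite /dotp big_split_ord /=; congr (_ + _); apply: eq_bigr => i _.
  by rewrite !row_mxEl.
by rewrite !row_mxEr.
Qed.

Lemma dotp_ge0 n (u : 'rV[R]_n) : 0 <= dotp u u.
Proof. by apply: sumr_ge0 => i _; rewrite -expr2 sqr_ge0. Qed.

Lemma enorm_sqr n (u : 'rV[R]_n) : enorm u ^+ 2 = dotp u u.
Proof. by rewrite sqr_sqrtr ?dotp_ge0. Qed.

(** Removes the square root, so that unit length can be checked blockwise. *)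
Lemma enorm_eq1 n (u : 'rV[R]_n) : enorm u = 1 <-> dotp u u = 1.
Proof.
split=> [u1|u1]; first by rewrite -enorm_sqr u1 expr1n.
by rewrite /enorm u1 sqrtr1.
Qed.

End DotProduct.

Theorem theorem2p1 (R : realType) (D k l : nat)
    (D_ge1 : (1 <= D)%N) (k_ge1 : (1 <= k)%N) (l_ge1 : (1 <= l)%N)
    (C : set 'rV[R]_D) (Y : set 'rV[R]_k)
    (C_kissing : kissing_configuration C) (Y_kissing : kissing_configuration Y)
    (t : 'I_l -> 'rV[R]_k) (t_inj : injective t)
    (t_norm : forall i, 0 < enorm (t i) < 1)
    (A : 'I_l -> set 'rV[R]_D) (A_sub : forall i, A i `<=` C) :
  let a := fun i : 'I_l => Num.sqrt (1 - enorm (t i) ^+ 2) in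
  let U := \bigcup_(i in [set: 'I_l]) A i in
  let Z : set 'rV[R]_(D + k) := [set row_mx x 0 | x in C `\` U] in
  let M : set 'rV[R]_(D + k) :=
    \bigcup_(i in [set: 'I_l]) [set row_mx (a i *: x) (t i) | x in A i] in
  let P : set 'rV[R]_(D + k) := [set row_mx 0 y | y in Y] in
  kissing_configuration (Z `|` M `|` P) <->
  (forall (i j : 'I_l) (x x' : 'rV[R]_D), A i x -> A j x' ->
     (x, i) <> (x', j) ->
     a i * a j * dotp x x' + dotp (t i) (t j) <= 1 / 2) /\
  (forall (i : 'I_l) (y : 'rV[R]_k), A i !=set0 -> Y y ->
     dotp (t i) y <= 1 / 2).
Proof.
move=> a U Z M P.
have [C1 C_le] := C_kissing; have [Y1 Y_le] := Y_kissing.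
(* [Num.sqrt] is 0 on negative reals, so squaring it back needs the bound on the norm of [t i]. *)
have a2 i : a i * a i = 1 - dotp (t i) (t i).
  rewrite -expr2 sqr_sqrtr ?enorm_sqr // -enorm_sqr subr_ge0.
  by rewrite expr_le1 ?sqrtr_ge0 // ltW //; case/andP: (t_norm i).
have a_gt0 i : 0 < a i.
  rewrite sqrtr_gt0 subr_gt0 expr_lt1 ?sqrtr_ge0 //.
  by case/andP: (t_norm i).
have a_le1 i : a i <= 1.
  by rewrite -[leRHS]sqrtr1 ler_sqrt // gerBl sqr_ge0.
split=> [[_ K_le]|[MM MP]].
  split=> [i j x x' Ax Ax' xi_neq|i y [x Ax] Yy].
    have := K_le (row_mx (a i *: x) (t i)) (row_mx (a j *: x') (t j)).
    rewrite dotp_row_mx dotpZl dotpZr mulrA; apply.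
    - by left; right; exists i => //; exists x.
    - by left; right; exists j => //; exists x'.
    (* Distinct labels give distinct points: the second block determines [i] by injectivity of [t],
       and then the first determines [x] because [a i] is nonzero. *)
    - move=> /eq_row_mx[axE /t_inj ij]; apply: xi_neq; subst j.
      congr pair; apply: (scalerI _ axE).
      by rewrite gt_eqF.
  have := K_le (row_mx (a i *: x) (t i)) (row_mx 0 y).
  rewrite dotp_row_mx dotp0r add0r; apply.
  - by left; right; exists i => //; exists x.
  - by right; exists y.
  (* A point of [M] is never in [P]: its first block is a nonzero multiple of a unit vector. *)
  - move=> /eq_row_mx[ax0 _].
    have /enorm_eq1 := C1 _ (A_sub _ _ Ax).
    have /eqP := ax0; rewrite scaler_eq0 gt_eqF //= => /eqP ->.
    by rewrite dotp0l => /eqP; rewrite eq_sym oner_eq0.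
have ZM_le u v : Z u -> M v -> dotp u v <= 1 / 2.
  move=> [x [Cx nUx] <-] [i _ [x' Ax' <-]].
  rewrite dotp_row_mx dotp0l addr0 dotpZr.
  (* This is where removing [U] from [C] matters: [x] differs from every lifted point, so the bound
     in [C] applies. *)
  have xx' : x <> x' by move=> xE; apply: nUx; exists i => //; rewrite xE.
  have := C_le _ _ Cx (A_sub _ _ Ax') xx'.
  (* Scaling the bound by [a i] gives at most [a i / 2], hence at most 1/2. *)
  have := a_gt0 i; have := a_le1 i; nra.
have ZP_le u v : Z u -> P v -> dotp u v <= 1 / 2.
  move=> [x _ <-] [y _ <-].
  by rewrite dotp_row_mx dotp0l dotp0r addr0 divr_ge0.
have MP_le u v : M u -> P v -> dotp u v <= 1 / 2.
  move=> [i _ [x Ax <-]] [y Yy <-].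
  by rewrite dotp_row_mx dotp0r add0r MP //; exists x.
split=> [u [[[x [Cx _] <-]|[i _ [x Ax <-]]]|[y Yy <-]]|].
- by apply/enorm_eq1; rewrite dotp_row_mx dotp0l addr0; apply/enorm_eq1/C1.
- apply/enorm_eq1; rewrite dotp_row_mx dotpZl dotpZr mulrA a2.
  have /enorm_eq1 -> := C1 _ (A_sub _ _ Ax).
  by rewrite mulr1 subrK.
- by apply/enorm_eq1; rewrite dotp_row_mx dotp0l add0r; apply/enorm_eq1/Y1.
move=> u v [[Zu|Mu]|Pu] [[Zv|Mv]|Pv] uv.
- case: Zu Zv uv => [x [Cx _] <-] [x' [Cx' _] <-] uv.
  rewrite dotp_row_mx dotp0l addr0; apply: C_le => // xx'.
  by apply: uv; rewrite xx'.
- exact: ZM_le.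
- exact: ZP_le.
- by rewrite dotpC; apply: ZM_le.
- case: Mu Mv uv => [i _ [x Ax <-]] [j _ [x' Ax' <-]] uv.
  (* Equal labels would give equal points, so distinct points meet the side condition of (i). *)
  rewrite dotp_row_mx dotpZl dotpZr mulrA; apply: MM => // -[xx' ij].
  by apply: uv; rewrite xx' ij.
- exact: MP_le.
- by rewrite dotpC; apply: ZP_le.
- by rewrite dotpC; apply: MP_le.
- case: Pu Pv uv => [y Yy <-] [y' Yy' <-] uv.
  rewrite dotp_row_mx dotp0l add0r; apply: Y_le => // yy'.
  by apply: uv; rewrite yy'.
Qed.
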